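(* Let $k$ be an algebraically closed field of characteristic $0$ and let $v$ be a discrete valuation of $K_2=k((X_1,X_2))$ over $k$ (in the sense of the context) with value group $\mathbb{Z}$. Then, after a finite number of monoidal transformations and changes of coordinates, one obtains elements $Y_1,Y_2\in R_{\hat v}$ such that $k((Y_1,Y_2))\subset\widehat K_2$, the valuation $\hat v$ restricts to a valuation $v'$ of $k((Y_1,Y_2))$ extending $v$, and $v'$ is the usual order function of $k((Y_1,Y_2))$ (with respect to $Y_1,Y_2$).
   Context: $R_2=k[[X_1,X_2]]$ with maximal ideal $(X_1,X_2)$ and quotient field $K_2$. A discrete valuation of $K_2\mid k$ is a rank-one discrete valuation trivial on $k$ whose center in $R_2$ is $(X_1,X_2)$. $\widehat K_2$ is the completion of $K_2$ with respect to $v$, $\hat v$ the extension, $R_{\hat v}$ its valuation ring with maximal ideal $\mathfrak m_{\hat v}$. Monoidal transformation: $X_1\mapsto Y_1$, $X_2\mapsto Y_1Y_2$ (when $v(X_2)>v(X_1)$, variables possibly permuted); change of coordinates: $X_1\mapsto Y_1$, $X_2\mapsto Y_2+cY_1$ with $c\in R_{\hat v}\setminus\mathfrak m_{\hat v}$; new variables are regarded as elements of $R_{\hat v}$. The usual order function of $k((Y_1,Y_2))$ assigns to a nonzero power series its order (lowest total degree of a nonzero monomial), extended to the quotient field. *)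

(* Defs.v *)
From HB Require Import structures.
From mathcomp Require Import all_boot all_order all_algebra.
Set Implicit Arguments. Unset Strict Implicit. Unset Printing Implicit Defensive.
Import Order.TTheory GRing.Theory Num.Theory.
Local Open Scope ring_scope.

(** Formal power series in two variables over k: the coefficient of X1^i X2^j. *)
Definition ps (k : Type) := nat -> nat -> k.

Section PS.
Variable k : fieldType.

Definition ps_C (c : k) : ps k := fun i j => if (i == 0%N) && (j == 0%N) then c else 0.
Definition ps_X1 : ps k := fun i j => if (i == 1%N) && (j == 0%N) then 1 else 0.
Definition ps_X2 : ps k := fun i j => if (i == 0%N) && (j == 1%N) then 1 else 0.
Definition ps_add (f g : ps k) : ps k := fun i j => f i j + g i j.
Definition ps_mul (f g : ps k) : ps k :=
  fun i j => \sum_(a < i.+1) \sum_(b < j.+1) f a b * g (i - a)%N (j - b)%N.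

Definition ps_nz (f : ps k) : Prop := exists i j, f i j != 0.

Definition ps_ord (f : ps k) (n : nat) : Prop :=
  (exists i j, (i + j)%N = n /\ f i j != 0) /\
  (forall i j, f i j != 0 -> (n <= i + j)%N).

(** v : valuation of K2 = Frac k[[X1,X2]] over k, rank one discrete, with
    center (X1,X2) in R2 = k[[X1,X2]], and value group Z.  A valuation of K2 is
    determined by (and given here through) its values on R2 \ {0}:
    v(f/g) = v f - v g. *)
Definition is_dval_K2 (v : ps k -> int) : Prop :=
  (forall f g, ps_nz f -> ps_nz g -> v (ps_mul f g) = v f + v g) /\
  (forall f g, ps_nz f -> ps_nz g -> ps_nz (ps_add f g) ->
      Num.min (v f) (v g) <= v (ps_add f g)) /\
  (forall c : k, c != 0 -> v (ps_C c) = 0) /\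
  (* center is the maximal ideal (X1,X2): R2 ⊆ R_v and m_v ∩ R2 = (X1,X2) *)
  (forall f, ps_nz f -> 0 <= v f) /\
  (forall f, ps_nz f -> (0 < v f <-> f 0%N 0%N = 0)) /\
  (forall n : int, exists f g, ps_nz f /\ ps_nz g /\ v f - v g = n).

Section Valued.
Variable L : fieldType.
Variable w : L -> int.

Definition is_val : Prop :=
  (forall x y, x != 0 -> y != 0 -> w (x * y) = w x + w y) /\
  (forall x y, x != 0 -> y != 0 -> x + y != 0 -> Num.min (w x) (w y) <= w (x + y)).

Definition vclose (N : int) (x y : L) : Prop := x - y = 0 \/ N <= w (x - y).

Definition vconv (u : nat -> L) (l : L) : Prop :=
  forall N : int, exists n0, forall n, (n0 <= n)%N -> vclose N (u n) l.

Definition vcauchy (u : nat -> L) : Prop :=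
  forall N : int, exists n0, forall m n, (n0 <= m)%N -> (n0 <= n)%N -> vclose N (u m) (u n).

(** (L, w, phi) is the completion of (K2, v): phi : R2 -> L is an injective
    ring morphism (hence extends to an embedding K2 -> L), w extends v,
    L is complete w.r.t. w and phi(K2) is dense in L.  The completion is
    characterized by these properties up to unique isometric isomorphism. *)
Definition is_completion (v : ps k -> int) (phi : ps k -> L) : Prop :=
  is_val /\
  (forall f g, phi (ps_add f g) = phi f + phi g) /\
  (forall f g, phi (ps_mul f g) = phi f * phi g) /\
  phi (ps_C 1) = 1 /\
  (forall f, ps_nz f -> phi f != 0 /\ w (phi f) = v f) /\
  (forall u, vcauchy u -> exists l, vconv u l) /\
  (forall x (N : int), exists f g, ps_nz g /\ vclose N x (phi f / phi g)).

(** One elementary step on a pair of "variables" (Z1, Z2) of R_w: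
    - monoidal transformation X1 = Y1, X2 = Y1 Y2 (when w X2 > w X1),
    - permutation of the two variables,
    - change of coordinates X1 = Y1, X2 = Y2 + c Y1 with c a unit of R_w. *)
Definition trans_step (p q : L * L) : Prop :=
  (p.1 != 0 /\ p.2 != 0 /\ w p.1 < w p.2 /\ q = (p.1, p.2 / p.1)) \/
  q = (p.2, p.1) \/
  (exists c, c != 0 /\ w c = 0 /\ q = (p.1, p.2 - c * p.1)).

Inductive trans_reach : L * L -> L * L -> Prop :=
| trans_refl p : trans_reach p p
| trans_cons p q r : trans_step p q -> trans_reach q r -> trans_reach p r.

Definition in_Rw (x : L) : Prop := x = 0 \/ 0 <= w x.

Definition ps_psum (phi : ps k -> L) (g : ps k) (Y1 Y2 : L) (n : nat) : L :=
  \sum_(i < n) \sum_(j < n - i) phi (ps_C (g i j)) * Y1 ^+ i * Y2 ^+ j.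

Definition ps_eval (phi : ps k -> L) (g : ps k) (Y1 Y2 : L) (s : L) : Prop :=
  vconv (ps_psum phi g Y1 Y2) s.

End Valued.
End PS.

(* Main.v *)
Require Import Defs.
From HB Require Import structures.
From mathcomp Require Import all_boot all_order all_algebra.
From mathcomp Require Import zify ring.
From Stdlib Require Import Classical ClassicalEpsilon FunctionalExtensionality.
Import Order.TTheory GRing.Theory Num.Theory.
Local Open Scope ring_scope.
Set Implicit Arguments. Unset Strict Implicit. Unset Printing Implicit Defensive.

(* The residue of a pair (Z1, Z2) of equal values w Z1 = w Z2 is the class of
   Z2 / Z1.  If it is transcendental over k, a form of degree n in (Z1, Z2) has
   value n w Z1, so w is w Z1 times the order function on k[[Z1, Z2]]; as this
   ring contains R2 and the value group is Z, w Z1 = 1.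

   Otherwise the residue lies in k, which is algebraically closed, and the
   algorithm goes on.  If it never met a transcendental residue, then at a pair
   (t, y) with w t minimal y would be a power series in t, so that L would be
   the completion of k(t), with residue field k.  This is impossible because
   k[[X1, X2]] has dimension 2: with w X1 = m and a uniformizer t, the ring R_w
   is generated by 1, ..., t^(m-1) over k[[X1]], hence 1, X2, ..., X2^m satisfy
   a linear relation over k[[X1]], which is a nonzero f in R2 with phi f = 0. *)

(** * Valuations *)

Section Valuation.
Variables (L : fieldType) (w : L -> int).
Hypothesis wval : is_val w.

(** The value of [w] at [0] is arbitrary; the first disjunct treats it as infinite. *)
Definition vge (N : int) (x : L) : Prop := x = 0 \/ N <= w x.

Lemma valM x y : x != 0 -> y != 0 -> w (x * y) = w x + w y.
Proof. by case: wval => + _; apply. Qed.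

Lemma val1 : w 1 = 0.
Proof.
have n1 : (1 : L) != 0 by exact: oner_neq0.
by have := valM n1 n1; rewrite mulr1; lia.
Qed.

Lemma valN x : w (- x) = w x.
Proof.
have [->|x0] := eqVneq x 0; first by rewrite oppr0.
have n1 : (-1 : L) != 0 by rewrite oppr_eq0 oner_neq0.
have w1 : w (-1) = 0 by have := valM n1 n1; rewrite mulrNN mulr1 val1; lia.
by rewrite -mulN1r valM // w1 add0r.
Qed.

Lemma valV x : x != 0 -> w x^-1 = - w x.
Proof.
by move=> x0; have := valM x0 (invr_neq0 x0); rewrite divff // val1; lia.
Qed.

Lemma valX x n : x != 0 -> w (x ^+ n) = w x * n%:Z.
Proof.
move=> x0; elim: n => [|n IH]; first by rewrite expr0 val1; lia.
by rewrite exprS valM ?expf_neq0 // IH; lia.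
Qed.

Lemma vge0 N : vge N 0.
Proof. by left. Qed.

Lemma vgeW M N x : M <= N -> vge N x -> vge M x.
Proof. by move=> MN [->|Nx]; [left | right; lia]. Qed.

Lemma vge_val N x : x != 0 -> vge N x -> N <= w x.
Proof. by move=> /eqP x0 []. Qed.

Lemma vgeD N x y : vge N x -> vge N y -> vge N (x + y).
Proof.
have [->|x0] := eqVneq x 0; first by rewrite add0r.
have [->|y0] := eqVneq y 0; first by rewrite addr0.
have [->|xy0] := eqVneq (x + y) 0; first by left.
move=> /(vge_val x0) Nx /(vge_val y0) Ny; right.
by case: wval => _ /(_ x y x0 y0 xy0); rewrite ge_min => /orP []; [exact: le_trans Nx | exact: le_trans Ny].
Qed.

Lemma vgeN N x : vge N x -> vge N (- x).
Proof. by case=> [->|Nx]; [left; rewrite oppr0 | right; rewrite valN]. Qed.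

Lemma vgeB N x y : vge N x -> vge N y -> vge N (x - y).
Proof. by move=> Nx /vgeN; apply: vgeD. Qed.

Lemma vgeM M N x y : vge M x -> vge N y -> vge (M + N) (x * y).
Proof.
have [->|x0] := eqVneq x 0; first by rewrite mul0r; left.
have [->|y0] := eqVneq y 0; first by rewrite mulr0; left.
by move=> /(vge_val x0) Mx /(vge_val y0) Ny; right; rewrite valM //; lia.
Qed.

Lemma vgeMl N x y : vge 0 x -> vge N y -> vge N (x * y).
Proof. by move=> x0 /(vgeM x0); rewrite add0r. Qed.

Lemma vgeX M x n : vge M x -> vge (M * n%:Z) (x ^+ n).
Proof.
move=> Mx; elim: n => [|n IH]; first by right; rewrite expr0 val1; lia.
by rewrite exprS; apply: vgeW (vgeM Mx IH); lia.
Qed.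

Lemma vge_sum N (I : Type) (r : seq I) (P : pred I) (F : I -> L) :
  (forall i, P i -> vge N (F i)) -> vge N (\sum_(i <- r | P i) F i).
Proof. by move=> NF; apply: big_ind => //; [left | apply: vgeD]. Qed.

Lemma vge_eq0 x : (forall n : nat, vge n%:Z x) -> x = 0.
Proof.
move=> h; apply/eqP; apply/negPn/negP => x0.
by have := vge_val x0 (h `|(w x + 1)%R|%N); lia.
Qed.

Lemma val_close x y : x != 0 -> vge (w x + 1) (y - x) -> y != 0 /\ w y = w x.
Proof.
move=> x0 hyx.
have y0 : y != 0.
  apply/eqP => y0; have := hyx; rewrite y0 add0r => /vgeN; rewrite opprK.
  by move=> /(vge_val x0); lia.
split=> //; have [e|yx0] := eqVneq (y - x) 0.
  by move/eqP: e; rewrite subr_eq0 => /eqP ->.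
have h := vge_val yx0 hyx.
have h1 : vge (w x) y.
  have -> : y = (y - x) + x by rewrite subrK.
  by apply: vgeD; right; lia.
have := vge_val y0 h1; rewrite le_eqVlt => /orP [/eqP //|h2].
have h3 : vge (w x + 1) x.
  have {2}-> : x = y - (y - x) by rewrite subKr.
  by apply: vgeB; right; lia.
by have := vge_val x0 h3; lia.
Qed.

Lemma vge_div N x y : y != 0 -> vge (N + w y) x -> vge N (x / y).
Proof.
move=> y0 /vgeM /(_ (or_intror (lexx (w y^-1)))); rewrite valV //.
by apply: vgeW; lia.
Qed.

Lemma vconv_unique u l l' : vconv w u l -> vconv w u l' -> l = l'.
Proof.
move=> ul ul'; apply/eqP; rewrite -subr_eq0; apply/eqP; apply: vge_eq0 => n.
case: (ul n) (ul' n) => n1 h1 [n2 h2].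
have -> : l - l' = (u (maxn n1 n2) - l') - (u (maxn n1 n2) - l) by ring.
by apply: vgeB; [apply/h2/leq_maxr | apply/h1/leq_maxl].
Qed.

(** This allows a series to be summed in another order, as after a blow-up. *)
Lemma vconv_close u u' l : (forall n, vge n%:Z (u n - u' n)) ->
  vconv w u l -> vconv w u' l.
Proof.
move=> uu' ul N; case: (ul N) => n0 h; exists (maxn n0 `|N|%N) => n.
rewrite geq_max => /andP [n0n Nn].
have -> : vclose w N (u' n) l = vge N ((u n - l) - (u n - u' n)).
  by have -> : (u n - l) - (u n - u' n) = u' n - l by ring.
by apply: vgeB; [apply: h | apply: vgeW (uu' n); lia].
Qed.

End Valuation.

(* Eliminating one column with a pivot keeps the coefficients in [B]. *)
Lemma subring_dependence (R : idomainType) (B : R -> Prop) :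
  B 0 -> B 1 -> (forall x y, B x -> B y -> B (x + y)) ->
  (forall x, B x -> B (- x)) -> (forall x y, B x -> B y -> B (x * y)) ->
  forall n (r : 'I_n.+1 -> nat -> R), (forall i l, B (r i l)) ->
  exists u : 'I_n.+1 -> R, [/\ forall i, B (u i), exists i, u i != 0 &
    forall l, (l < n)%N -> \sum_(i < n.+1) u i * r i l = 0].
Proof.
move=> B0 B1 BD BN BM; elim=> [|n IH] r Br.
  by exists (fun=> 1); split=> //; exists ord0; apply: oner_neq0.
have Bsum m (F : 'I_m -> R) : (forall i, B (F i)) -> B (\sum_(i < m) F i).
  by move=> BF; apply: big_ind.
have [[p rp0]|r0] := classic (exists p, r p n != 0).
  pose r' (i : 'I_n.+1) l := r p n * r (lift p i) l - r (lift p i) n * r p l.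
  have [i l|u [Bu [i0 ui0] ur]] := IH r'; first by apply: BD; [|apply: BN]; apply: BM.
  (* Scaling by the pivot replaces division, which [B] need not allow; the coefficient at [p] is the
     one that column [n] then forces. *)
  pose u' i := if unlift p i is Some j then r p n * u j
               else - \sum_(j < n.+1) u j * r (lift p j) n.
  have u'p : u' p = - \sum_(j < n.+1) u j * r (lift p j) n.
    by rewrite /u' unlift_none.
  have u'l j : u' (lift p j) = r p n * u j by rewrite /u' liftK.
  exists u'; split.
  - move=> i; rewrite /u'; case: unliftP => [j _|_]; first exact: BM.
    by apply/BN/Bsum => j; apply: BM.
  - by exists (lift p i0); rewrite u'l mulf_neq0.
  - move=> l; rewrite ltnS leq_eqVlt (@bigD1_ord _ _ _ _ p) //= u'p.
    rewrite (eq_bigr _ (fun i _ => congr1 ( *%R^~ _) (u'l i))).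
    case: eqVneq => [-> _|_ /= ln].
      rewrite mulNr mulr_suml addrC; apply/eqP; rewrite subr_eq0; apply/eqP.
      by apply: eq_bigr => i _; ring.
    rewrite -[RHS](ur l ln) mulNr mulr_suml -sumrN -big_split /=.
    by apply: eq_bigr => i _; rewrite /r'; ring.
have {}r0 i : r i n = 0.
  by apply/eqP; apply/negPn/negP => h; apply: r0; exists i.
have [i l|u [Bu [i0 ui0] ur]] := IH (fun i => r (lift ord0 i)); first exact: Br.
exists (fun i => if unlift ord0 i is Some j then u j else 0); split.
- by move=> i; case: unliftP.
- by exists (lift ord0 i0); rewrite liftK.
- move=> l; rewrite ltnS leq_eqVlt; case: eqVneq => [-> _|_ /= ln].
    by apply: big1 => i _; rewrite r0 mulr0.
  rewrite big_ord_recl unlift_none mul0r add0r -[RHS](ur l ln).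
  by apply: eq_bigr => i _; rewrite liftK.
Qed.

(** * Power series in two variables *)

Section PowerSeries.
Variable k : fieldType.
Implicit Types f g : ps k.

(** The inclusion of $k[[X_1]]$ in $R_2$. *)
Definition ps_X1emb (c : nat -> k) : ps k := fun i j => if j == 0%N then c i else 0.
Definition ps_shift1 f : ps k := fun i j => f i.+1 j.
Definition ps_shift2 f : ps k := fun i j => f i j.+1.

Lemma ps_ext f g : (forall i j, f i j = g i j) -> f = g.
Proof.
move=> fg; apply: functional_extensionality => i.
by apply: functional_extensionality => j.
Qed.

Lemma ps_mul_C (c : k) f i j : ps_mul (ps_C c) f i j = c * f i j.
Proof.
rewrite /ps_mul big_ord_recl big_ord_recl /= /ps_C /= !subn0.
rewrite big1 => [|b _]; last by rewrite mul0r.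
rewrite big1 => [|a _]; first by rewrite !addr0.
by rewrite big1 // => b _; rewrite mul0r.
Qed.

Lemma ps_mulX1 f i j : ps_mul (ps_X1 k) f i j = if i is i'.+1 then f i' j else 0.
Proof.
rewrite /ps_mul /ps_X1; case: i => [|i].
  by rewrite big_ord1 big1 // => b _; rewrite mul0r.
rewrite big_ord_recl big1 ?add0r => [|b _]; last by rewrite mul0r.
rewrite big_ord_recl big_ord_recl /= mul1r !subn0.
have -> : (i.+1 - bump 0 0 = i)%N by rewrite /bump; lia.
rewrite big1 ?addr0 => [|b _]; last by rewrite mul0r.
by rewrite big1 ?addr0 // => a _; rewrite big1 // => b _; rewrite mul0r.
Qed.

Lemma ps_mulX2 f i j : ps_mul (ps_X2 k) f i j = if j is j'.+1 then f i j' else 0.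
Proof.
rewrite /ps_mul /ps_X2 big_ord_recl [X in _ + X]big1 ?addr0 => [|a _]; last first.
  by rewrite big1 // => b _; rewrite mul0r.
case: j => [|j]; first by rewrite big_ord1 mul0r.
rewrite big_ord_recl /= mul0r add0r big_ord_recl /= mul1r subn0.
have -> : (j.+1 - bump 0 0 = j)%N by rewrite /bump; lia.
by rewrite big1 ?addr0 // => b _; rewrite mul0r.
Qed.

Lemma ps_decomp2 f :
  f = ps_add (ps_X1emb (f^~ 0%N)) (ps_mul (ps_X2 k) (ps_shift2 f)).
Proof.
apply: ps_ext => i j; rewrite /ps_add ps_mulX2 /ps_X1emb /ps_shift2.
by case: j => [|j] /=; rewrite ?addr0 ?add0r.
Qed.

Lemma ps_X1emb_decomp (c : nat -> k) :
  ps_X1emb c = ps_add (ps_C (c 0%N)) (ps_mul (ps_X1 k) (ps_X1emb (fun n => c n.+1))).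
Proof.
apply: ps_ext => i j; rewrite /ps_add ps_mulX1 /ps_X1emb /ps_C.
by case: i j => [|i] [|j] /=; rewrite ?addr0 ?add0r.
Qed.

(** Monomials divisible by both variables go to the [ps_X1] part, so the cofactor of [ps_X2] is a
    series in the second variable alone. *)
Lemma ps_decomp f :
  f = ps_add (ps_add (ps_C (f 0%N 0%N)) (ps_mul (ps_X1 k) (ps_shift1 f)))
     (ps_mul (ps_X2 k) (fun i j => if i == 0%N then f 0%N j.+1 else 0)).
Proof.
apply: ps_ext => i j; rewrite /ps_add ps_mulX1 ps_mulX2 /ps_shift1 /ps_C.
by case: i j => [|i] [|j] /=; rewrite ?addr0 ?add0r.
Qed.

Lemma ps_X1embM (c d : nat -> k) :
  ps_mul (ps_X1emb c) (ps_X1emb d) =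
  ps_X1emb (fun i => \sum_(a < i.+1) c a * d (i - a)%N).
Proof.
apply: ps_ext => i j; rewrite /ps_mul /ps_X1emb.
case: (eqVneq j 0%N) => [->|j0].
  by apply: eq_bigr => a _; rewrite big_ord1.
apply: big1 => a _; apply: big1 => b _; case: (eqVneq (b : nat) 0%N) => [->|b0].
  by rewrite subn0 (negPf j0) mulr0.
by rewrite mul0r.
Qed.

Lemma ps_nzPn f : ~ ps_nz f -> f = ps_C 0.
Proof.
move=> f0; apply: ps_ext => i j; rewrite /ps_C if_same; apply/eqP/negPn/negP => h.
by apply: f0; exists i, j.
Qed.

Lemma ps_ord_exists f : ps_nz f -> exists n, ps_ord f n.
Proof.
move=> [i [j]]; have [n] := ubnP (i + j)%N; elim: n i j => // n IH i j ijn fij.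
have [[i' [j' [h f']]]|h] := classic (exists i' j', (i' + j' < i + j)%N /\ f i' j' != 0).
  by apply: IH f'; lia.
exists (i + j)%N; split; first by exists i, j.
by move=> i' j' f'; rewrite leqNgt; apply/negP => h'; apply: h; exists i', j'.
Qed.

End PowerSeries.

(** * Evaluation of power series in the completion *)

Section Completion.
Variables (k : closedFieldType) (v : ps k -> int).
Variables (L : fieldType) (w : L -> int) (phi : ps k -> L).
Hypotheses (hv : is_dval_K2 v) (hL : is_completion w v phi).

Let wval : is_val w. Proof. by case: hL. Qed.

Notation vge := (vge w).
Notation psum := (ps_psum phi).
Notation ps_eval := (ps_eval w phi).
Notation X1 := (phi (ps_X1 k)).
Notation X2 := (phi (ps_X2 k)).

Lemma phiD f g : phi (ps_add f g) = phi f + phi g.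
Proof. by case: hL => _ []. Qed.

Lemma phiM f g : phi (ps_mul f g) = phi f * phi g.
Proof. by case: hL => _ [_ []]. Qed.

Lemma phi_nz f : ps_nz f -> phi f != 0 /\ w (phi f) = v f.
Proof. by case: hL => _ [_ [_ [_ []]]] + _; apply. Qed.

Lemma phi_vge0 f : vge 0 (phi f).
Proof.
have [f0|/ps_nzPn f0] := classic (ps_nz f).
  by right; case: (phi_nz f0) => _ ->; case: hv => _ [_ [_ [h _]]]; apply: h.
have : phi (ps_add f f) = phi f.
  by congr phi; apply: ps_ext => i j; rewrite f0 /ps_add /ps_C if_same addr0.
by rewrite phiD => /(canRL (addrK _)); rewrite subrr; left.
Qed.

Definition iota (c : k) : L := phi (ps_C c).

Lemma iota_is_zmod_morphism : zmod_morphism iota.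
Proof.
have iotaD a b : iota (a + b) = iota a + iota b.
  rewrite /iota -phiD; congr phi; apply: ps_ext => i j; rewrite /ps_add /ps_C.
  by case: ifP; rewrite ?addr0.
move=> a b; apply: (canRL (addrK _)); by rewrite -iotaD subrK.
Qed.

Lemma iota_is_monoid_morphism : monoid_morphism iota.
Proof.
split=> [|a b]; first by case: hL => _ [_ [_ []]].
rewrite /iota -phiM; congr phi; apply: ps_ext => i j; rewrite ps_mul_C /ps_C.
by case: ifP; rewrite ?mulr0.
Qed.

HB.instance Definition _ := GRing.isZmodMorphism.Build k L iota iota_is_zmod_morphism.
HB.instance Definition _ := GRing.isMonoidMorphism.Build k L iota iota_is_monoid_morphism.

Lemma iota_val c : c != 0 -> w (iota c) = 0.
Proof.
move=> c0; have nz : ps_nz (ps_C c) by exists 0%N, 0%N.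
by case: (phi_nz nz) => _ ->; case: hv => _ [_ [h _]]; apply: h.
Qed.

Lemma iota_vge0 c : vge 0 (iota c).
Proof. exact: phi_vge0. Qed.

Lemma phi_vge1 f : ps_nz f -> f 0%N 0%N = 0 -> phi f != 0 /\ vge 1 (phi f).
Proof.
move=> nz f0; case: (phi_nz nz) => f1 f2; split=> //; right; rewrite f2.
by case: hv => _ [_ [_ [_ [h _]]]]; have := (h f nz).2 f0; lia.
Qed.

Lemma X1_vge1 : X1 != 0 /\ vge 1 X1.
Proof. by apply: phi_vge1 => //; exists 1%N, 0%N; rewrite /= oner_neq0. Qed.

Lemma X2_vge1 : X2 != 0 /\ vge 1 X2.
Proof. by apply: phi_vge1 => //; exists 0%N, 1%N; rewrite /= oner_neq0. Qed.

(** * Homogeneous forms and convergence of partial sums *)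

Definition ps_form (g : ps k) (Z1 Z2 : L) (n : nat) : L :=
  \sum_(j < n.+1) iota (g (n - j)%N j) * Z1 ^+ (n - j) * Z2 ^+ j.

Lemma ps_formC g Z1 Z2 n : ps_form g Z1 Z2 n = ps_form (fun i j => g j i) Z2 Z1 n.
Proof.
rewrite /ps_form (reindex_inj rev_ord_inj) /=; apply: eq_bigr => j _.
have jn := ltn_ord j; rewrite subSS subKn; last by lia.
by rewrite mulrAC.
Qed.

(** [ps_psum] truncates by total degree: index [n] collects the monomials of degree less than
    [n]. *)
Lemma psumS g Z1 Z2 n : psum g Z1 Z2 n.+1 = psum g Z1 Z2 n + ps_form g Z1 Z2 n.
Proof.
rewrite ps_formC /ps_psum big_ord_recr /= subSn // subnn big_ord1 /=.
rewrite /ps_form big_ord_recr /= subnn addrA; congr (_ + _); last first.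
  by rewrite mulrAC.
rewrite -big_split /=; apply: eq_bigr => i _; rewrite subSn; last exact: ltnW.
by rewrite big_ord_recr /=; congr (_ + _); rewrite mulrAC.
Qed.

Lemma psumE g Z1 Z2 n : psum g Z1 Z2 n = \sum_(d < n) ps_form g Z1 Z2 d.
Proof.
elim: n => [|n IH]; first by rewrite /ps_psum !big_ord0.
by rewrite psumS IH big_ord_recr.
Qed.

Lemma ps_term_vge M c Z1 Z2 i j : vge M Z1 -> vge M Z2 ->
  vge (M * (i + j)%N%:Z) (iota c * Z1 ^+ i * Z2 ^+ j).
Proof.
move=> h1 h2; rewrite -mulrA; apply: vgeMl => //; first exact: iota_vge0.
by rewrite PoszD mulrDr; apply: vgeM => //; apply: vgeX.
Qed.

Lemma ps_form_vge M g Z1 Z2 n : vge M Z1 -> vge M Z2 ->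
  vge (M * n%:Z) (ps_form g Z1 Z2 n).
Proof.
move=> h1 h2; apply: vge_sum => // j _.
have {1}-> : n = (n - j + j)%N by have := ltn_ord j; lia.
exact: ps_term_vge.
Qed.

(** The forms of degree at least [n] have value at least [M * n]. Convergence uses [M = 1], the
    isolation of a leading form [M = w Z1]. *)
Lemma psum_tail M g Z1 Z2 n m : 0 <= M -> vge M Z1 -> vge M Z2 -> (n <= m)%N ->
  vge (M * n%:Z) (psum g Z1 Z2 m - psum g Z1 Z2 n).
Proof.
move=> M0 h1 h2; elim: m => [|m IH] nm.
  by move: nm; rewrite leqn0 => /eqP ->; rewrite subrr; apply: vge0.
have [<-|nm'] := eqVneq n m.+1; first by rewrite subrr; apply: vge0.
rewrite psumS addrAC; apply: vgeD => //; first by apply: IH; lia.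
by apply: (vgeW _ (ps_form_vge g m h1 h2)); apply: ler_wpM2l => //; lia.
Qed.

Lemma ps_eval_exists g Z1 Z2 : vge 1 Z1 -> vge 1 Z2 -> exists s, ps_eval g Z1 Z2 s.
Proof.
move=> h1 h2; case: hL => _ [_ [_ [_ [_ [cpl _]]]]]; apply: cpl => N.
exists `|N|%N => m n Nm Nn.
have tail l : (`|N| <= l)%N -> vge N (psum g Z1 Z2 l - psum g Z1 Z2 `|N|).
  by move=> Nl; apply: vgeW (psum_tail g _ h1 h2 Nl) => //; lia.
rewrite /vclose; set a := psum _ _ _ m; set b := psum _ _ _ n.
have -> : a - b = (a - psum g Z1 Z2 `|N|) - (b - psum g Z1 Z2 `|N|) by ring.
by apply: vgeB => //; apply: tail.
Qed.

(** No continuity of [phi] is assumed; it follows from [phi] having nonnegative values. By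
    [ps_decomp], each induction step multiplies the errors of two cofactors by [X1] and [X2], of
    value at least 1. *)
Lemma phi_psum_close n f : vge n%:Z (phi f - psum f X1 X2 n).
Proof.
elim: n f => [|n IH] f.
  by rewrite /ps_psum big_ord0 subr0; apply: phi_vge0.
pose h : ps k := fun i j => if i == 0%N then f 0%N j.+1 else 0.
have -> : psum f X1 X2 n.+1 =
    iota (f 0%N 0%N) + X1 * psum (ps_shift1 f) X1 X2 n + X2 * psum h X1 X2 n.
  rewrite {1}/ps_psum big_ord_recl /= subn0 big_ord_recl /= !expr0 !mulr1.
  rewrite -!addrA; congr (_ + _); rewrite addrC; congr (_ + _).
    rewrite mulr_sumr; apply: eq_bigr => i _; rewrite subSS mulr_sumr.
    by apply: eq_bigr => j _; rewrite /bump /= add1n exprS; ring.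
  (* Only the row [i = 0] of the sum for [h] is nonzero, and it is present only for positive [n]. *)
  case: n {IH} => [|n]; first by rewrite /ps_psum !big_ord0 mulr0.
  rewrite /ps_psum [X in _ = _ * X]big_ord_recl /= [X in _ * (_ + X)]big1 => [|i _]; last first.
    by apply: big1 => j _; rewrite [phi _](rmorph0 iota) !mul0r.
  rewrite addr0 subn0 mulr_sumr; apply: eq_bigr => j _.
  by rewrite /bump /= add1n exprS expr0 !mulr1; ring.
rewrite {1}(ps_decomp f) !phiD !phiM -/h -/(iota _).
set p1 := phi (ps_shift1 f); set p2 := phi h.
set s1 := psum (ps_shift1 f) _ _ _; set s2 := psum h _ _ _.
have -> : iota (f 0%N 0%N) + X1 * p1 + X2 * p2 - (iota (f 0%N 0%N) + X1 * s1 + X2 * s2)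
   = X1 * (p1 - s1) + X2 * (p2 - s2) by ring.
have -> : n.+1%:Z = 1 + n%:Z by lia.
by apply: vgeD => //; apply: vgeM => //; first [apply: IH | by case: X1_vge1 | by case: X2_vge1].
Qed.

Lemma phi_eval f : ps_eval f X1 X2 (phi f).
Proof.
move=> N; exists `|N|%N => n Nn; rewrite /vclose -opprB; apply: vgeN => //.
by apply: vgeW (phi_psum_close n f) => //; lia.
Qed.

(** * Preservation of $R_2 \subset k[[Z_1,Z_2]]$ by the elementary steps *)

Definition contains_R2 (Z1 Z2 : L) : Prop :=
  forall f, exists a, ps_eval a Z1 Z2 (phi f).

Lemma contains_R2_swap Z1 Z2 : contains_R2 Z1 Z2 -> contains_R2 Z2 Z1.
Proof.
move=> h f; case: (h f) => a ha; exists (fun i j => a j i) => N.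
case: (ha N) => n0 {}ha; exists n0 => n /ha.
by rewrite !psumE; under eq_bigr => d _ do rewrite ps_formC.
Qed.

(** The substitution is linear, so by the binomial theorem each form becomes a form of the same
    degree, and partial sums agree exactly. Taking [c] in [k] keeps the coefficients in [k]. *)
Lemma contains_R2_shear c Z1 Z2 :
  contains_R2 Z1 Z2 -> contains_R2 Z1 (Z2 - iota c * Z1).
Proof.
move=> h f; case: (h f) => a ha.
(* For [j < q] the truncated exponent [j - q] is harmless, since the binomial coefficient
   vanishes. *)
pose a' : ps k := fun p q =>
  \sum_(j < (p + q).+1) a (p + q - j)%N j * c ^+ (j - q) *+ 'C(j, q).
exists a'; move: ha; set Y := Z2 - _; have -> : Z2 = iota c * Z1 + Y by rewrite /Y; ring.
clearbody Y; move=> ha N.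
case: (ha N) => n0 {}ha; exists n0 => n /ha; rewrite !psumE.
suff e d : ps_form a Z1 (iota c * Z1 + Y) d = ps_form a' Z1 Y d.
  by under eq_bigr => d _ do rewrite e.
rewrite /ps_form.
transitivity (\sum_(j < d.+1) \sum_(q < d.+1)
    iota (a (d - j)%N j * c ^+ (j - q) *+ 'C(j, q)) * Z1 ^+ (d - q) * Y ^+ q).
  apply: eq_bigr => j _; rewrite exprDn mulr_sumr.
  rewrite (big_ord_widen d.+1 (fun i => iota (a (d - j)%N j) * Z1 ^+ (d - j) *
      ((iota c * Z1) ^+ (j - i) * Y ^+ i *+ 'C(j, i)))) // big_mkcond.
  apply: eq_bigr => q _; case: ltnP => qj; last by rewrite bin_small // mulr0n rmorph0 !mul0r.
  have -> : (d - q = (d - j) + (j - q))%N by have := ltn_ord j; lia.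
  rewrite rmorphMn rmorphM rmorphXn exprMn exprD !mulrnAl mulrnAr /=; congr (_ *+ _).
  move: (iota (a _ _)) (iota c ^+ _) (Z1 ^+ (d - j)) (Z1 ^+ _) (Y ^+ _) => *.
  by ring.
rewrite exchange_big /=; apply: eq_bigr => q _; rewrite -!mulr_suml -rmorph_sum /a'.
by rewrite subnK // -ltnS.
Qed.

(** Since $Z_1^i (Z_1 Z_2)^j = Z_1^{i+j} Z_2^j$, total degrees change. The two partial sums of index
    [n] differ only by monomials of degree at least [n] in [Z1], [Z2], which have value at least
    [n]. *)
Lemma contains_R2_blowup Z1 Z2 : vge 1 Z1 -> vge 1 Z2 ->
  contains_R2 Z1 (Z1 * Z2) -> contains_R2 Z1 Z2.
Proof.
move=> h1 h2 h f; case: (h f) => a ha.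
pose a' : ps k := fun p q => if (q <= p)%N then a (p - q)%N q else 0.
exists a'; apply: vconv_close ha => // n.
rewrite psumE /ps_psum -sumrB; apply: vge_sum => // d _; rewrite /ps_form.
pose T j := iota (a (d - j)%N j) * Z1 ^+ d * Z2 ^+ j.
have dn := ltn_ord d.
rewrite (eq_bigr (fun j : 'I_d.+1 => T j)) => [|j _]; last first.
  have e : Z1 ^+ d = Z1 ^+ (d - j) * Z1 ^+ j by rewrite -exprD subnK // -ltnS.
  rewrite /T e exprMn.
  by move: (iota _) (Z1 ^+ (d - j)) (Z1 ^+ _) (Z2 ^+ _) => *; ring.
rewrite (eq_bigr (fun j : 'I_(n - d) => if (j <= d)%N then T j else 0)) => [|j _]; last first.
  by rewrite /a' -/(iota _); case: ifP => // _; rewrite rmorph0 !mul0r.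
rewrite (big_ord_widen n T) // (big_ord_widen n (fun j => if (j <= d)%N then T j else 0)) ?leq_subr //.
rewrite big_mkcond [X in _ - X]big_mkcond -sumrB; apply: vge_sum => // j _.
rewrite ltnS; case: (leqP j d) => jd; last by rewrite if_same subrr; apply: vge0.
case: ltnP => jn; first by rewrite subrr; apply: vge0.
by rewrite subr0; apply: vgeW (ps_term_vge _ d j h1 h2) => //; lia.
Qed.

(** * The residue field is larger than k *)

Lemma uniformizer_exists : exists2 t, t != 0 & w t = 1.
Proof.
case: hv => _ [_ [_ [_ [_ /(_ 1) [f [g [f0 [g0 fg]]]]]]]].
have [[pf0 wf] [pg0 wg]] := (phi_nz f0, phi_nz g0).
exists (phi f / phi g); first by rewrite mulf_neq0 ?invr_eq0.
by rewrite (valM wval) ?invr_eq0 // (valV wval) // wf wg.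
Qed.

Lemma phi_X1emb (c : nat -> k) :
  phi (ps_X1emb c) = iota (c 0%N) + X1 * phi (ps_X1emb (fun n => c n.+1)).
Proof. by rewrite [in LHS]ps_X1emb_decomp phiD phiM. Qed.

(** Later it turns a linear relation between powers of [X2] over $k[[X_1]]$ into the vanishing of
    one [phi f]. *)
Lemma phi_X2_polynomial m f : (forall i j, (m <= j)%N -> f i j = 0) ->
  phi f = \sum_(j < m) phi (ps_X1emb (f^~ j)) * X2 ^+ j.
Proof.
elim: m f => [|m IH] f f0.
  rewrite big_ord0 -[RHS](rmorph0 iota); congr phi.
  by apply: ps_ext => i j; rewrite f0 // /ps_C if_same.
rewrite {1}(ps_decomp2 f) phiD phiM big_ord_recl expr0 mulr1; congr (_ + _).
rewrite (IH (ps_shift2 f)) => [|i j mj]; last by rewrite /ps_shift2 f0.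
by rewrite mulr_sumr; apply: eq_bigr => j _; rewrite exprS mulrCA.
Qed.

Definition X1series (b : L) : Prop := exists c, b = phi (ps_X1emb c).

Lemma X1series_iota c : X1series (iota c).
Proof.
exists (fun i => if i == 0%N then c else 0); congr phi; apply: ps_ext => i j.
by rewrite /ps_C /ps_X1emb; case: i j => [|i] [|j].
Qed.

Lemma X1seriesD a b : X1series a -> X1series b -> X1series (a + b).
Proof.
move=> [c ->] [d ->]; exists (fun i => c i + d i); rewrite -phiD; congr phi.
by apply: ps_ext => i j; rewrite /ps_add /ps_X1emb; case: ifP; rewrite ?addr0.
Qed.

Lemma X1seriesM a b : X1series a -> X1series b -> X1series (a * b).
Proof. by move=> [c ->] [d ->]; rewrite -phiM ps_X1embM; eexists. Qed.

Section SmallResidueField.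
Hypothesis residue_k : forall a, vge 0 a -> exists c, vge 1 (a - iota c).

(** The first [m] digits of the [t]-adic expansion: subtract the residue, divide by [t], repeat. *)
Lemma uniformizer_expansion t m a : t != 0 -> w t = 1 -> vge 0 a ->
  exists (c : nat -> k) a',
    vge 0 a' /\ a = \sum_(r < m) iota (c r) * t ^+ r + t ^+ m * a'.
Proof.
move=> t0 wt; elim: m a => [|m IH] a a0.
  by exists (fun=> 0), a; rewrite big_ord0 add0r mul1r.
have [c0 ac] := residue_k a0.
have [|c [a' [a'0 e]]] := IH ((a - iota c0) / t).
  by apply: vge_div; rewrite // wt add0r.
exists (fun r => if r is r'.+1 then c r' else c0), a'; split=> //.
rewrite big_ord_recl expr0 mulr1 -addrA exprS -mulrA -(subrKC (iota c0) a).
congr (_ + _); rewrite -[LHS](divfK t0) e mulrDl mulr_suml; congr (_ + _).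
  by apply: eq_bigr => r _; rewrite /= /bump add1n exprSr mulrA.
by rewrite mulrC.
Qed.

(** As [t ^+ m] and [X1] have the same value, a round of [m] digits leaves a remainder divisible by
    [X1]. The [r]-th digits of all rounds are the coefficients of [b r] as a series in [X1]. *)
Lemma module_generation t m a : t != 0 -> w t = 1 -> w X1 = m%:Z -> vge 0 a ->
  exists b : nat -> L, (forall r, X1series (b r)) /\ a = \sum_(r < m) b r * t ^+ r.
Proof.
move=> t0 wt wX1; have [X10 X1ge1] := X1_vge1.
(* The assumption on [b] stands inside the existential, so that choice gives a total function
   [F]. *)
have step b : exists p : (nat -> k) * L, vge 0 b ->
    vge 0 p.2 /\ b = \sum_(r < m) iota (p.1 r) * t ^+ r + X1 * p.2.
  have [b0|nb0] := classic (vge 0 b); last by exists (fun=> 0, 0).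
  have [c [b' [b'0 e]]] := uniformizer_expansion m t0 wt b0.
  exists (c, t ^+ m * b' / X1) => _; split=> /=.
    apply: vge_div; rewrite // add0r -(addr0 (w X1)); apply: vgeM => //.
    by right; rewrite (valX wval) // wt wX1 mul1r.
  by rewrite {1}e mulrCA divff ?mulr1.
pose F b := proj1_sig (constructive_indefinite_description _ (step b)).
have hF b : vge 0 b -> vge 0 (F b).2 /\
    b = \sum_(r < m) iota ((F b).1 r) * t ^+ r + X1 * (F b).2.
  exact: (proj2_sig (constructive_indefinite_description _ (step b))).
pose digit b r : nat -> k := fun n => (F (iter n (fun x => (F x).2) b)).1 r.
(* The error of the expansion of [b] is [X1] times that of the remainder of [b]; iterating, its
   value exceeds every bound, so it is zero. *)
pose D b := b - \sum_(r < m) phi (ps_X1emb (digit b r)) * t ^+ r.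
have D_vge0 b : vge 0 b -> vge 0 (D b).
  move=> b0; apply: vgeB => //; apply: vge_sum => // r _.
  apply: vgeMl => //; first exact: phi_vge0.
  by right; rewrite (valX wval) // wt.
have DS b : vge 0 b -> D b = X1 * D (F b).2.
  move=> b0; rewrite /D {1}(hF b b0).2 mulrBr mulr_sumr.
  under [X in _ - X = _]eq_bigr => r _ do rewrite phi_X1emb mulrDl.
  rewrite big_split /= opprD addrACA subrr add0r; congr (_ - _).
  apply: eq_bigr => r _; rewrite mulrA; congr (_ * phi _ * _).
  by apply: ps_ext => i j; rewrite /ps_X1emb /digit iterSr.
have D_vge n b : vge 0 b -> vge n%:Z (D b).
  elim: n b => [|n IH] b b0; first exact: D_vge0.
  rewrite DS // -[n.+1]add1n PoszD; apply: vgeM => //.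
  by apply: IH; case: (hF b b0).
move=> a0; exists (fun r => phi (ps_X1emb (digit a r))); split; first by eexists.
by apply/eqP; rewrite -subr_eq0; apply/eqP/(@vge_eq0 _ w) => n; apply: D_vge.
Qed.

Lemma small_residue_field_absurd : False.
Proof.
have [t t0 wt] := uniformizer_exists.
have [X10 X1ge1] := X1_vge1; have [X20 X2ge1] := X2_vge1.
have [m wX1] : exists m, w X1 = m%:Z.
  by exists `|w X1|%N; have := vge_val X10 X1ge1; lia.
have gen (j : nat) : exists b : nat -> L,
    (forall r, X1series (b r)) /\ X2 ^+ j = \sum_(r < m) b r * t ^+ r.
  apply: module_generation => //; apply: (vgeW _ (vgeX wval j X2ge1)); lia.
pose b (j : nat) := proj1_sig (constructive_indefinite_description _ (gen j)).
have hb j : (forall r, X1series (b j r)) /\ X2 ^+ j = \sum_(r < m) b j r * t ^+ r.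
  exact: (proj2_sig (constructive_indefinite_description _ (gen j))).
(* The [m.+1] powers of [X2] have only [m] coordinates each. *)
have [|||i l|u [Bu [j0 uj0] ub]] :=
    @subring_dependence L X1series _ _ X1seriesD _ X1seriesM m (fun j : 'I_m.+1 => b j).
- by rewrite -(rmorph0 iota); apply: X1series_iota.
- by rewrite -(rmorph1 iota); apply: X1series_iota.
- move=> x Bx; rewrite -mulN1r -(rmorphN1 iota).
  by apply: X1seriesM Bx; apply: X1series_iota.
- exact: (hb i).1.
pose c j := proj1_sig (constructive_indefinite_description _ (Bu j)).
have hc j : u j = phi (ps_X1emb (c j)).
  exact: (proj2_sig (constructive_indefinite_description _ (Bu j))).
(* The relation read as a polynomial in the second variable, of degree at most [m]; [insub] extends
   it by zero. *)
pose f : ps k := fun i j => if insub j is Some j' then c j' i else 0.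
have fE : phi f = \sum_(j < m.+1) u j * X2 ^+ j.
  rewrite (@phi_X2_polynomial m.+1) => [|i j mj]; last by rewrite /f insubF // ltnNge mj.
  apply: eq_bigr => j _; rewrite hc; congr (phi _ * _).
  by apply: ps_ext => i j'; rewrite /f /ps_X1emb valK.
have f0 : phi f = 0.
  rewrite fE; under eq_bigr => j _ do rewrite (hb j).2 mulr_sumr.
  rewrite exchange_big big1 //= => r _.
  under eq_bigr => j _ do rewrite mulrA.
  by rewrite -mulr_suml ub // mul0r.
have [/phi_nz []|/ps_nzPn fz] := classic (ps_nz f); first by rewrite f0 eqxx.
move/eqP: uj0; apply; rewrite hc -(rmorph0 iota); congr phi.
apply: ps_ext => i j; have := congr1 (fun g => g i (j0 : nat)) fz.
by rewrite /f valK /ps_C /ps_X1emb !if_same => ->; rewrite if_same.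
Qed.

End SmallResidueField.

(** * The resolution process *)

Definition evalk (p : {poly k}) (t : L) : L := (map_poly iota p).[t].

Lemma evalk0 t : evalk 0 t = 0.
Proof. by rewrite /evalk map_poly0 horner0. Qed.

Lemma evalkD p q t : evalk (p + q) t = evalk p t + evalk q t.
Proof. by rewrite /evalk rmorphD hornerD. Qed.

Lemma evalkM p q t : evalk (p * q) t = evalk p t * evalk q t.
Proof. by rewrite /evalk rmorphM hornerM. Qed.

Lemma evalkC c t : evalk c%:P t = iota c.
Proof. by rewrite /evalk map_polyC hornerC. Qed.

Lemma evalkX t : evalk 'X t = t.
Proof. by rewrite /evalk map_polyX hornerX. Qed.

Lemma evalk_vge0 p t : vge 0 t -> vge 0 (evalk p t).
Proof.
move=> t0; elim/poly_ind: p => [|p c IH].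
  by rewrite evalk0; apply: vge0.
rewrite evalkD evalkM evalkX evalkC; apply: vgeD => //; last exact: iota_vge0.
exact: vgeMl.
Qed.

Lemma trans_reach_rcons p q r : trans_reach w p q -> trans_step w q r -> trans_reach w p r.
Proof.
move=> pq; elim: pq => [x|x y z xy _ IH] qr.
  by apply: trans_cons qr _; apply: trans_refl.
by apply: trans_cons xy _; apply: IH.
Qed.

(** Reachability is bundled with the invariants under which series in [Z1], [Z2] converge and
    represent $R_2$. *)
Definition reached (Z1 Z2 : L) : Prop :=
  [/\ trans_reach w (X1, X2) (Z1, Z2), vge 1 Z1, vge 1 Z2 & contains_R2 Z1 Z2].

Lemma reached_start : reached X1 X2.
Proof.
split; [exact: trans_refl | by case: X1_vge1 | by case: X2_vge1 |].
by move=> f; exists f; apply: phi_eval.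
Qed.

Lemma reached_swap Z1 Z2 : reached Z1 Z2 -> reached Z2 Z1.
Proof.
move=> [r h1 h2 c]; split=> //; last exact: contains_R2_swap.
by apply: trans_reach_rcons r _; right; left.
Qed.

Lemma reached_shear c Z1 Z2 : c != 0 -> reached Z1 Z2 -> reached Z1 (Z2 - iota c * Z1).
Proof.
move=> c0 [r h1 h2 h]; split=> //; last exact: contains_R2_shear.
  apply: trans_reach_rcons r _; right; right; exists (iota c).
  by rewrite fmorph_eq0 c0 iota_val.
by apply: vgeB => //; apply: vgeMl => //; apply: iota_vge0.
Qed.

Lemma reached_blowup Z1 Z2 : Z1 != 0 -> Z2 != 0 -> w Z1 < w Z2 ->
  reached Z1 Z2 -> reached Z1 (Z2 / Z1).
Proof.
move=> z1 z2 lt12 [r h1 h2 h].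
have h12 : vge 1 (Z2 / Z1) by apply: vge_div => //; right; lia.
split=> //; last by apply: contains_R2_blowup; rewrite // mulrCA divff ?mulr1.
by apply: trans_reach_rcons r _; left.
Qed.

(* Equal values, and the residue of [Z2 / Z1] is transcendental over [k]. *)
Definition transcendental_pair (Z1 Z2 : L) : Prop :=
  [/\ Z1 != 0, Z2 != 0, w Z1 = w Z2 &
      forall p : {poly k}, p != 0 -> ~ vge 1 (evalk p (Z2 / Z1))].

(** * Residues of pairs of equal value *)

Lemma vge1_factor x y : vge 0 x -> ~ vge 1 x -> vge 1 (x * y) -> vge 1 y.
Proof.
move=> x_ge0 nx xy.
have x0 : x != 0 by apply/eqP => x0; apply: nx; left.
have wx : w x = 0.
  have := vge_val x0 x_ge0; rewrite le_eqVlt => /orP [/eqP //|h].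
  by case: nx; right; lia.
by rewrite -(mulKf x0 y) mulrC; apply: vge_div; rewrite // wx addr0.
Qed.

(** A polynomial killing the residue splits into linear factors over the closed field [k], and one
    of them must have positive value at [Z2 / Z1]. Its root is nonzero because [Z2 / Z1] has value
    0. *)
Lemma algebraic_residue Z1 Z2 : Z1 != 0 -> Z2 != 0 -> w Z1 = w Z2 ->
  ~ transcendental_pair Z1 Z2 -> exists2 c, c != 0 & vge 1 (Z2 / Z1 - iota c).
Proof.
move=> z1 z2 w12 ntr; set u := Z2 / Z1.
have u0 : u != 0 by rewrite mulf_neq0 ?invr_eq0.
have wu : w u = 0 by rewrite (valM wval) ?invr_eq0 // (valV wval) // w12 subrr.
have [p p0 pu] : exists2 p : {poly k}, p != 0 & vge 1 (evalk p u).
  apply: NNPP => h; apply: ntr; split=> // p p0 pu; apply: h; by exists p.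
have [r pr] := closed_field_poly_normal p.
have {pr pu} : vge 1 (\prod_(z <- r) (u - iota z)).
  have nl : ~ vge 1 (iota (lead_coef p)).
    move=> /vge_val; rewrite fmorph_eq0 lead_coef_eq0 p0 iota_val ?lead_coef_eq0 //.
    by move=> /(_ isT).
  apply: vge1_factor (iota_vge0 _) nl _.
  move: pu; rewrite {1}pr -mul_polyC evalkM evalkC /evalk map_prod_XsubC horner_prod.
  by under eq_bigr => z _ do rewrite hornerXsubC.
elim: r => [|z r IH]; first by rewrite big_nil => -[/eqP|]; rewrite ?oner_eq0 ?(val1 wval).
rewrite big_cons; have [uz _|nuz /vge1_factor uzr] := classic (vge 1 (u - iota z)).
  exists z => //; apply/eqP => z0; move: uz; rewrite z0 rmorph0 subr0.
  by move=> /(vge_val u0); rewrite wu.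
by apply/IH/uzr => //; apply: vgeB => //; [right; rewrite wu | apply: iota_vge0].
Qed.

(** Dehomogenizing, the form is [Z1 ^+ n] times a nonzero polynomial at [Z2 / Z1], which has value 0
    by transcendence. *)
Lemma transcendental_pair_form Z1 Z2 g n : transcendental_pair Z1 Z2 -> ps_ord g n ->
  ps_form g Z1 Z2 n != 0 /\ w (ps_form g Z1 Z2 n) = w Z1 * n%:Z.
Proof.
move=> [z1 z2 w12 tr] [[i [j [ijn gij]]] _].
pose p := \poly_(l < n.+1) g (n - l)%N l; pose u := Z2 / Z1.
have -> : ps_form g Z1 Z2 n = Z1 ^+ n * evalk p u.
  rewrite /evalk (@horner_coef_wide _ n.+1); last first.
    by rewrite size_map_poly size_poly.
  rewrite mulr_sumr; apply: eq_bigr => l _; rewrite coef_map coef_poly ltn_ord /=.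
  have e : Z1 ^+ n = Z1 ^+ (n - l) * Z1 ^+ l by rewrite -exprD subnK // -ltnS.
  rewrite e exprMn exprVn; have := expf_neq0 l z1.
  by move: (Z1 ^+ l) (Z1 ^+ _) (Z2 ^+ _) => x y z x0; field.
have p0 : p != 0.
  apply/eqP => /(congr1 (fun q : {poly k} => q`_j)); rewrite coef0 coef_poly.
  have -> : (j < n.+1)%N by lia.
  have -> : (n - j = i)%N by lia.
  exact/eqP.
have u_ge0 : vge 0 u.
  by right; rewrite (valM wval) ?invr_eq0 // (valV wval) // w12 subrr.
have pu0 : evalk p u != 0 by apply/eqP => e; apply: (tr p p0); left.
rewrite mulf_neq0 ?expf_neq0 // (valM wval) ?expf_neq0 // (valX wval) //.
have := vge_val pu0 (evalk_vge0 p u_ge0); rewrite le_eqVlt => /orP [/eqP <-|h].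
  by rewrite addr0.
by case: (tr p p0); right; rewrite -/u; lia.
Qed.

(** The leading form decides: lower forms vanish, and the tail has value at least [w Z1 * n.+1]. *)
Lemma transcendental_pair_eval Z1 Z2 g n s : vge 1 Z1 ->
  transcendental_pair Z1 Z2 -> ps_ord g n -> ps_eval g Z1 Z2 s ->
  s != 0 /\ w s = w Z1 * n%:Z.
Proof.
move=> h1 tr gn gs; have [z1 z2 w12 _] := tr.
have [F0 wF] := transcendental_pair_form tr gn; rewrite -wF.
apply: val_close => //; case: (gs (w Z1 * n%:Z + 1)) => n0.
(* Index at least [n.+1] ensures that the leading form is part of the partial sum. *)
move=> /(_ (maxn n0 n.+1) (leq_maxl _ _)); set S := psum _ _ _ _ => sS.
have -> : s - ps_form g Z1 Z2 n = (S - ps_form g Z1 Z2 n) - (S - s) by ring.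
rewrite wF; apply: vgeB => //.
have psum_n : psum g Z1 Z2 n = 0.
  rewrite psumE big1 // => d _; rewrite /ps_form big1 // => j _.
  suff -> : g (d - j)%N j = 0 by rewrite rmorph0 !mul0r.
  apply/eqP/negPn/negP => /gn.2; have := ltn_ord d; have := ltn_ord j; lia.
have -> : ps_form g Z1 Z2 n = psum g Z1 Z2 n.+1 by rewrite psumS psum_n add0r.
have wZ1 := vge_val z1 h1.
have W1 : vge (w Z1) Z1 by right.
have W2 : vge (w Z1) Z2 by right; rewrite w12.
by apply: vgeW (psum_tail g _ W1 W2 (leq_maxr n0 n.+1)) => //; lia.
Qed.

(** All values on $R_2$ are multiples of [w Z1], while 1 is a difference of two of them. *)
Lemma transcendental_pair_val Z1 Z2 : reached Z1 Z2 ->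
  transcendental_pair Z1 Z2 -> w Z1 = 1.
Proof.
move=> [_ h1 h2 R2] tr; have [z1 _ _ _] := tr; have wZ1 := vge_val z1 h1.
have val_mult f : ps_nz f -> exists n : nat, v f = w Z1 * n%:Z.
  move=> f0; have [pf0 <-] := phi_nz f0; have [a fa] := R2 f.
  have [/ps_ord_exists [n an]|/ps_nzPn a0] := classic (ps_nz a).
    by exists n; case: (transcendental_pair_eval h1 tr an fa).
  case/eqP: pf0; apply: (vconv_unique wval fa) => N; exists 0%N => n _; left.
  rewrite subr0 a0 psumE big1 // => d _; rewrite /ps_form big1 // => j _.
  by rewrite /ps_C if_same rmorph0 !mul0r.
case: hv => _ [_ [_ [_ [_ /(_ 1) [f [g [/val_mult [n ->] [/val_mult [m ->] e]]]]]]]].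
have e' : w Z1 * (n%:Z - m%:Z) = 1 by rewrite mulrBr.
have : 0 < n%:Z - m%:Z by rewrite -(pmulr_rgt0 _ (_ : 0 < w Z1)) ?e' //; lia.
by move: e'; move: (n%:Z - m%:Z) => d; nia.
Qed.

(** * The closure of $k[t]$ in [L] *)

Definition polynomial_limit (t x : L) : Prop :=
  forall N : nat, exists p, vge N%:Z (x - evalk p t).

Lemma polynomial_limit_evalk t p : polynomial_limit t (evalk p t).
Proof. by move=> N; exists p; rewrite subrr; apply: vge0. Qed.

Lemma polynomial_limit_iota t c : polynomial_limit t (iota c).
Proof. by rewrite -(evalkC c t); apply: polynomial_limit_evalk. Qed.

Lemma polynomial_limitD t x y :
  polynomial_limit t x -> polynomial_limit t y -> polynomial_limit t (x + y).
Proof.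
move=> hx hy N; have [[p hp] [q hq]] := (hx N, hy N); exists (p + q).
rewrite evalkD.
have -> : x + y - (evalk p t + evalk q t) = (x - evalk p t) + (y - evalk q t) by ring.
exact: vgeD.
Qed.

Lemma polynomial_limitM t x y : vge 0 t -> vge 0 y ->
  polynomial_limit t x -> polynomial_limit t y -> polynomial_limit t (x * y).
Proof.
move=> t0 y0 hx hy N; have [[p hp] [q hq]] := (hx N, hy N); exists (p * q).
rewrite evalkM.
have -> : x * y - evalk p t * evalk q t =
    y * (x - evalk p t) + evalk p t * (y - evalk q t) by ring.
by apply: vgeD => //; apply: vgeMl => //; apply: evalk_vge0.
Qed.

Lemma polynomial_limitX t x n : vge 0 t -> vge 0 x ->
  polynomial_limit t x -> polynomial_limit t (x ^+ n).
Proof.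
move=> t0 x0 hx; elim: n => [|n IH].
  by rewrite expr0 -(rmorph1 iota); apply: polynomial_limit_iota.
by rewrite exprSr; apply: polynomial_limitM.
Qed.

Lemma polynomial_limit_eval t y g s : vge 0 t -> vge 0 y ->
  polynomial_limit t y -> ps_eval g t y s -> polynomial_limit t s.
Proof.
move=> t0 y0 hy gs N; case: (gs N%:Z) => n0 /(_ n0 (leqnn _)).
set S := psum _ _ _ _ => sS.
suff [p hp] : exists p, vge N%:Z (S - evalk p t).
  exists p; have -> : s - evalk p t = (S - evalk p t) - (S - s) by ring.
  exact: vgeB.
suff : polynomial_limit t S by apply.
have ht : polynomial_limit t t.
  by rewrite -[X in polynomial_limit _ X]evalkX; apply: polynomial_limit_evalk.
have h0 : polynomial_limit t 0.
  by rewrite -(rmorph0 iota); apply: polynomial_limit_iota.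
apply: big_ind => // [|i _]; first exact: polynomial_limitD.
apply: big_ind => // [|j _]; first exact: polynomial_limitD.
have yj : vge 0 (y ^+ j) by have := vgeX wval j y0; rewrite mul0r.
have ti : vge 0 (t ^+ i) by have := vgeX wval i t0; rewrite mul0r.
apply: polynomial_limitM => //; last exact: polynomial_limitX.
apply: polynomial_limitM => //; last exact: polynomial_limitX.
exact: polynomial_limit_iota.
Qed.

(** The witnesses come from the lowest nonzero monomial of [p]. *)
Lemma evalk_leading t p : t != 0 -> vge 1 t -> p != 0 ->
  exists c (e : nat), c != 0 /\ vge (w t * e%:Z + 1) (evalk p t - iota c * t ^+ e).
Proof.
move=> t0 t1; elim/poly_ind: p => [|p c IH]; first by rewrite eqxx.
rewrite evalkD evalkM evalkX evalkC.
have [->|c0 _] := eqVneq c 0; last first.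
  exists c, 0%N; split=> //; rewrite expr0 mulr1 addrK mulr0 add0r.
  apply: vgeMl => //; apply: evalk_vge0; exact: vgeW t1.
rewrite addr0 rmorph0 addr0 => pX0.
have p0 : p != 0 by apply: contraNneq pX0 => ->; rewrite mul0r.
have [c' [e [c'0 h]]] := IH p0; exists c', e.+1; split=> //.
rewrite exprSr mulrA -mulrBl.
by apply: vgeW (vgeM wval h (or_intror (lexx (w t)))); lia.
Qed.

(** A polynomial in [t] that agrees with [phi f] beyond its value has the same leading monomial. *)
Lemma phi_leading t f : t != 0 -> vge 1 t -> polynomial_limit t (phi f) ->
  phi f != 0 -> exists c (e : nat), [/\ c != 0, w (phi f) = w t * e%:Z &
    vge (w (phi f) + 1) (phi f - iota c * t ^+ e)].
Proof.
move=> t0 t1 lf f0; have [p hp] := lf `|(w (phi f) + 1)%R|%N.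
have {}hp : vge (w (phi f) + 1) (phi f - evalk p t) by apply: vgeW hp; lia.
have [q0 wq] : evalk p t != 0 /\ w (evalk p t) = w (phi f).
  by apply: val_close => //; rewrite -opprB; apply: vgeN.
have p0 : p != 0.
  by apply: contraNneq q0 => ->; rewrite evalk0.
have [c [e [c0 h]]] := evalk_leading t0 t1 p0; exists c, e.
have ct0 : iota c * t ^+ e != 0 by rewrite mulf_neq0 ?expf_neq0 ?fmorph_eq0.
have wct : w (iota c * t ^+ e) = w t * e%:Z.
  by rewrite (valM wval) ?expf_neq0 ?fmorph_eq0 // iota_val // (valX wval) // add0r.
have [_ wq'] := val_close wval ct0 (eq_ind_r (fun z => vge (z + 1) _) h wct).
have wf : w (phi f) = w t * e%:Z by rewrite -wq wq' wct.
split=> //; rewrite -[X in vge _ X](subrKA (evalk p t)).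
by apply: vgeD => //; rewrite wf.
Qed.

(** By density [a] is congruent to a quotient [phi f / phi g]. With leading monomials $c t^e$ and $d
    t^{e'}$, the case $e < e'$ contradicts [vge 0 a], and the residue is 0 if $e > e'$ and $c/d$ if
    $e = e'$. *)
Lemma polynomial_limits_residue t : t != 0 -> vge 1 t ->
  (forall f, polynomial_limit t (phi f)) ->
  forall a, vge 0 a -> exists c, vge 1 (a - iota c).
Proof.
move=> t0 t1 lim a a0.
case: hL => _ [_ [_ [_ [_ [_ /(_ a 1) [f [g [g0 ab]]]]]]]].
set b := phi f / phi g in ab.
suff [c bc] : exists c, vge 1 (b - iota c).
  exists c; have -> : a - iota c = (a - b) + (b - iota c) by ring.
  exact: vgeD.
have [f0|f0] := eqVneq (phi f) 0.
  by exists 0; rewrite /b f0 rmorph0 mul0r subr0; apply: vge0.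
have [pg0 _] := phi_nz g0.
have [c [e [c0 wf hf]]] := phi_leading t0 t1 (lim f) f0.
have [d [e' [d0 wg hg]]] := phi_leading t0 t1 (lim g) pg0.
have wt := vge_val t0 t1.
have b0 : b != 0 by rewrite mulf_neq0 ?invr_eq0.
have wb : w b = w t * e%:Z - w t * e'%:Z.
  by rewrite (valM wval) ?invr_eq0 // (valV wval) // wf wg.
have b_ge0 : vge 0 b.
  have -> : b = a - (a - b) by ring.
  by apply: vgeB => //; apply: vgeW ab.
have := vge_val b0 b_ge0; rewrite wb; have [ee'|ee'|ee'] := ltngtP e e'.
- by nia.
- by move=> _; exists 0; rewrite rmorph0 subr0; right; rewrite wb; nia.
move=> _; exists (c / d); rewrite fmorph_div.
have id0 : iota d != 0 by rewrite fmorph_eq0.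
have -> : b - iota c / iota d = ((phi f - iota c * t ^+ e) -
    (iota c / iota d) * (phi g - iota d * t ^+ e')) / phi g.
  rewrite /b -ee'; move: (iota c) (iota d) id0 (t ^+ e) => x y y0 z.
  by field; rewrite y0 pg0.
apply: vge_div => //; rewrite addrC; apply: vgeB => //.
  by move: hf; rewrite wf wg ee'.
by apply: vgeMl => //; rewrite -fmorph_div; apply: iota_vge0.
Qed.

(** * Termination of the resolution process *)

Lemma minimal_reached : exists t y, [/\ reached t y, t != 0 &
  forall t' y', reached t' y' -> t' != 0 -> w t <= w t'].
Proof.
have [X10 _] := X1_vge1; move: reached_start X10.
have [n] := ubnP `|w X1|%N; move: X1 X2; elim: n => // n IH t y tn ty t0.
have [[t' [y' [ty' t'0 lt]]]|h] :=
    classic (exists t' y', [/\ reached t' y', t' != 0 & w t' < w t]).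
  apply: (IH t' y') => //; have [_ t1 _ _] := ty; have [_ t'1 _ _] := ty'.
  by have := vge_val t0 t1; have := vge_val t'0 t'1; lia.
exists t, y; split=> // t' y' ty' t'0; rewrite leNgt; apply/negP => lt.
by apply: h; exists t', y'.
Qed.

(* Otherwise, along pairs [(t, y)] with [w t] minimal, [y = (c + y') t] with
   [(t, y')] again reached, so that [y] expands as a power series in [t]. *)
Lemma transcendental_pair_exists :
  exists Z1 Z2, reached Z1 Z2 /\ transcendental_pair Z1 Z2.
Proof.
apply: NNPP => ntr; have [t [y0 [ty0 t0 tmin]]] := minimal_reached.
have t1 : vge 1 t by case: ty0.
have t_ge0 : vge 0 t by apply: vgeW t1.
(* The alternative [y = 0] covers an expansion that stops after finitely many terms. *)
have step y : y = 0 \/ reached t y ->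
    exists c y', y = (iota c + y') * t /\ (y' = 0 \/ reached t y').
  have [-> _|yn0 [/eqP|ty]] := eqVneq y 0; first by exists 0, 0; rewrite rmorph0 addr0 mul0r; split; [|left].
    by rewrite (negPf yn0).
  (* Minimality applied to the swapped pair gives [w t <= w y]; equality calls for a shear before
     the blow-up, strict inequality for a blow-up alone. *)
  have := tmin _ _ (reached_swap ty) yn0; rewrite le_eqVlt => /orP [/eqP wty|wty].
    have [|c c0 hc] := algebraic_residue t0 yn0 wty.
      by move=> tr; apply: ntr; exists t, y.
    exists c, ((y - iota c * t) / t).
    split; first by rewrite mulrDl divfK // subrKC.
    have [->|yc0] := eqVneq (y - iota c * t) 0; first by left; rewrite mul0r.
    right; apply: reached_blowup => //; last exact: reached_shear.
    have e : y - iota c * t = (y / t - iota c) * t by rewrite mulrBl divfK.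
    have : 1 + w t <= w (y - iota c * t).
      by apply: vge_val => //; rewrite e; apply: vgeM => //; right.
    by lia.
  exists 0, (y / t); rewrite rmorph0 add0r divfK //; split=> //.
  by right; apply: reached_blowup.
(* Each use of [step] contributes a factor [t], hence at least one more unit of precision. *)
have lim_y y : y = 0 \/ reached t y -> polynomial_limit t y.
  move=> hy N; elim: N y hy => [|N IH] y hy.
    exists 0; rewrite evalk0 subr0.
    by case: hy => [->|[_ _ h _]]; [apply: vge0 | apply: vgeW h].
  have [c [y' [-> hy']]] := step y hy; have [p hp] := IH y' hy'.
  exists ((c%:P + p) * 'X); rewrite evalkM evalkD evalkC evalkX -mulrBl.
  have -> : iota c + y' - (iota c + evalk p t) = y' - evalk p t by ring.
  by apply: vgeW (vgeM wval hp t1); lia.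
apply: small_residue_field_absurd; apply: polynomial_limits_residue t0 t1 _ => f.
have [_ _ y1 /(_ f) [a fa]] := ty0.
apply: polynomial_limit_eval fa => //; first exact: vgeW y1.
by apply: lim_y; right.
Qed.

Lemma ps_eval1 Z1 Z2 : ps_eval (ps_C 1) Z1 Z2 1.
Proof.
move=> N; exists 1%N => -[//|n _]; left; apply/eqP; rewrite subr_eq0 psumE.
rewrite big_ord_recl /ps_form big_ord1 !mulr1 -/(iota _) rmorph1.
rewrite big1 ?addr0 // => d _; rewrite big1 // => j _.
by rewrite /ps_C /bump /=; case: (j : nat) => [|i]; rewrite ?andbF /= rmorph0 !mul0r.
Qed.

End Completion.

Theorem theorem10 (k : closedFieldType) (hchar : [pchar k] =i pred0)
    (v : ps k -> int) (hv : is_dval_K2 v)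
    (L : fieldType) (w : L -> int) (phi : ps k -> L)
    (hL : is_completion w v phi) :
  exists Y1 Y2 : L,
    (* obtained from (X1, X2) by finitely many monoidal transformations and
       changes of coordinates *)
    trans_reach w (phi (ps_X1 k), phi (ps_X2 k)) (Y1, Y2) /\
    in_Rw w Y1 /\ in_Rw w Y2 /\
    (* k[[Y1,Y2]] embeds in the completion and hat v restricted to it is the
       order function (hence so on k((Y1,Y2))) *)
    (forall (g : ps k) (n : nat), ps_ord g n ->
       exists s, ps_eval w phi g Y1 Y2 s /\ s != 0 /\ w s = n%:Z) /\
    (* K2 ⊆ k((Y1,Y2)) inside the completion, so v' extends v *)
    (forall f : ps k, exists a b sa sb,
       ps_nz b /\ ps_eval w phi a Y1 Y2 sa /\ ps_eval w phi b Y1 Y2 sb /\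
       sb != 0 /\ phi f = sa / sb).
Proof.
have [Y1 [Y2 [rY tr]]] := transcendental_pair_exists hv hL.
have [reach h1 h2 R2] := rY; have wY1 := transcendental_pair_val hv hL rY tr.
have wval : is_val w by case: hL.
have ev g n : ps_ord g n -> exists s, ps_eval w phi g Y1 Y2 s /\ s != 0 /\ w s = n%:Z.
  move=> gn; have [s gs] := ps_eval_exists hv hL g h1 h2; exists s; split=> //.
  by have := transcendental_pair_eval hv hL h1 tr gn gs; rewrite wY1 mul1r.
exists Y1, Y2; split=> //; split; first by apply: vgeW h1.
split; first by apply: vgeW h2.
split=> // f; have [a fa] := R2 f.
have one : ps_nz (ps_C (1 : k)) by exists 0%N, 0%N; rewrite oner_neq0.
(* The denominator is 1, since $R_2$ already lies in $k[[Y_1,Y_2]]$. *)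
exists a, (ps_C 1), (phi f), 1; split=> //; split=> //.
split; last by rewrite oner_neq0 divr1.
exact: ps_eval1 hL _ _.
Qed.
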